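(* Assume that the rival model is linear, $\eta_2(x,\theta_{(2)})=\theta_{(2)}^Tf(x)$ with $\theta_{(2)}\in\Theta_{(2)}=\mathbb{R}^{m_2}$, where $f=(f_1,\ldots,f_{m_2})^T$ is a vector of continuous real-valued functions on $\mathcal{X}$. Then a design $\xi^*$ is $T$-optimal (for the fixed function $\eta$ against $\eta_2$) if and only if it is $D_1$-optimal in the extended linear regression model $$y=\theta_{(2)}^Tf(x)+\beta\,\eta(x)+\varepsilon .$$
   Context: $\mathcal{X}$ is the design space (a topological space). A design is a probability measure on $\mathcal{X}$ with finite support. $\eta$ is a fixed continuous real-valued function on $\mathcal{X}$ (the first model $\eta(x)=\eta_1(x,\theta_{(1)})$ with $\theta_{(1)}$ fixed; it need not be linear, and the models need not be nested). For a design $\xi$, $$\Delta(\xi)=\inf_{\theta_{(2)}\in\mathbb{R}^{m_2}}\int_{\mathcal{X}}(\eta(x)-\theta_{(2)}^Tf(x))^2\,d\xi(x),$$ and a design is $T$-optimal if it maximizes $\Delta(\xi)$ over all designs. Standing assumptions: the infimum defining $\Delta(\xi)$ is attained, and a $T$-optimal design exists. $D_1$-optimality in a linear regression model $y=\theta_{(2)}^Tf(x)+\beta h(x)+\varepsilon$ with parameter $(\theta_{(2)}^T,\beta)^T\in\mathbb{R}^{m_2+1}$: put $\tilde f(x)=(f^T(x),h(x))^T\in\mathbb{R}^{m_2+1}$, $\tilde M(\xi)=\int_{\mathcal{X}}\tilde f(x)\tilde f^T(x)\,d\xi(x)$, and $e_{m_2+1}=(0,\ldots,0,1)^T\in\mathbb{R}^{m_2+1}$.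 A design is $D_1$-optimal if it satisfies $e_{m_2+1}\in\mathrm{Range}(\tilde M(\xi))$ and maximizes $$(e_{m_2+1}^T\tilde M^-(\xi)e_{m_2+1})^{-1}$$ among all designs $\xi$ with $e_{m_2+1}\in\mathrm{Range}(\tilde M(\xi))$, where $\tilde M^-$ denotes a generalized inverse of $\tilde M$ (when $\tilde M(\xi)$ is nonsingular this value equals $\det\tilde M(\xi)/\det M(\xi)$ with $M(\xi)=\int_{\mathcal{X}} f(x)f^T(x)\,d\xi(x)$). Here $h=\eta$.
   Formalization: The formal theorem additionally assumes that η is not of the form θᵀf on the design space; if it is, Δ vanishes identically, so every design is T-optimal while none satisfies the range condition, and the equivalence fails. *)

(* Defs.v *)
From HB Require Import structures.
From mathcomp Require Import all_boot all_order all_algebra.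
From mathcomp Require Import all_classical all_reals all_analysis.
Import Order.TTheory GRing.Theory Num.Theory.
Import numFieldNormedType.Exports.

Set Implicit Arguments.
Unset Strict Implicit.
Unset Printing Implicit Defensive.

Local Open Scope classical_set_scope.
Local Open Scope ring_scope.

(* A ptopologicalType is a nonempty topological space with a distinguished
   point, which the library requires of its measurable types; the point plays
   no role. *)
Definition borel (X : ptopologicalType) := g_sigma_algebraType (@open X).
HB.instance Definition _ (X : ptopologicalType) := Measurable.on (borel X).

Section Designs.
Context {R : realType} {X : ptopologicalType} {m : nat}.
Implicit Types (xi : probability (borel X) R) (eta : X -> R)
  (f : X -> 'cV[R]_m) (theta : 'cV[R]_m).

(* A design is a probability measure carried by a finite set S. Since X is an
   arbitrary topological space, S need not be a Borel set; when it is (e.g. in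
   a T1 space) the condition is equivalent to xi S = 1. *)
Definition is_design xi : Prop :=
  exists2 S : set X, finite_set S &
    forall A : set (borel X), measurable A -> S `<=` A -> xi A = 1%:E.

Definition sq_dist eta f xi theta : R :=
  \int[xi]_x (eta x - (theta^T *m f x) 0 0) ^+ 2.

Definition Delta eta f xi : R := inf (range (sq_dist eta f xi)).

Definition T_optimal eta f xi : Prop :=
  is_design xi /\
  forall xi', is_design xi' -> Delta eta f xi' <= Delta eta f xi.

Definition ext_reg f (h : X -> R) (x : X) : 'cV[R]_(m + 1) :=
  col_mx (f x) (h x)%:M.

Definition info_mx k (g : X -> 'cV[R]_k) xi : 'M[R]_k :=
  \matrix_(i, j) \int[xi]_x ((g x *m (g x)^T) i j).

Definition e_last : 'cV[R]_(m + 1) := col_mx 0 1%:M.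

(* e_last lies in Range(M~(xi)). If h is a linear combination of the components
   of f then no design is feasible, while Delta h f vanishes identically; this
   degenerate case has to be excluded when comparing the two criteria. *)
Definition D1_feasible f (h : X -> R) xi : Prop :=
  exists v : 'cV[R]_(m + 1), info_mx (ext_reg f h) xi *m v = e_last.

(* pinvmx is one generalized inverse (lemma pinvmx_ginv); on D1-feasible
   designs any other one gives the same value (lemma D1_value_ginv). *)
Definition D1_value f (h : X -> R) xi : R :=
  ((e_last^T *m pinvmx (info_mx (ext_reg f h) xi) *m e_last) 0 0)^-1.

Definition D1_optimal f (h : X -> R) xi : Prop :=
  [/\ is_design xi, D1_feasible f h xi &
    forall xi', is_design xi' -> D1_feasible f h xi' ->
      D1_value f h xi' <= D1_value f h xi].

Lemma pinvmx_ginv k (M : 'M[R]_k) : M *m pinvmx M *m M = M.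
Proof. exact: mulmxKpV. Qed.

Lemma info_mx_sym k (g : X -> 'cV[R]_k) xi : (info_mx g xi)^T = info_mx g xi.
Proof.
apply/matrixP => i j; rewrite !mxE; apply: eq_Rintegral => x _.
by rewrite !mxE; apply: eq_bigr => l _; rewrite !mxE mulrC.
Qed.

Lemma D1_value_ginv f (h : X -> R) xi (G : 'M[R]_(m + 1)) :
  D1_feasible f h xi ->
  info_mx (ext_reg f h) xi *m G *m info_mx (ext_reg f h) xi =
    info_mx (ext_reg f h) xi ->
  ((e_last^T *m G *m e_last) 0 0)^-1 = D1_value f h xi.
Proof.
move=> [v Mv] MGM; rewrite /D1_value -Mv trmx_mul info_mx_sym.
set M := info_mx _ _ in MGM *.
have E (H : 'M[R]_(m + 1)) : M *m H *m M = M ->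
    v^T *m M *m H *m (M *m v) = v^T *m M *m v.
  by move=> MHM; rewrite -[in RHS]MHM !mulmxA.
by rewrite !E // pinvmx_ginv.
Qed.

End Designs.
Arguments e_last {R m}.

(* Main.v *)
Require Import Defs.
From HB Require Import structures.
From mathcomp Require Import all_boot all_order all_algebra.
From mathcomp Require Import all_classical all_reals all_analysis.
From mathcomp Require Import measurable_realfun ring lra.
Import Order.TTheory GRing.Theory Num.Theory.
Import numFieldNormedType.Exports.
Local Open Scope classical_set_scope.
Local Open Scope ring_scope.

(** Write M for the information matrix of the extended regressor (f, eta) under
    a design, and e for the last unit vector. The squared distance between eta
    and theta^T f is the quadratic form of M at w = (-theta, 1), so computing
    Delta means minimising a nonnegative quadratic form over the vectors whose
    last coordinate is 1. At an attained minimum the derivative vanishes in all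
    directions orthogonal to e, that is, M w is a multiple of e; pairing with w
    identifies the factor, and the normal equations read M w = Delta e
    ([normal_equations]).

    Everything about a single design follows from this identity. If Delta <> 0,
    then w / Delta solves M v = e and the design is feasible for the
    D_1-criterion; if Delta = 0 and M v = e were solvable, symmetry of M would
    give 1 = e^T w = v^T M w = 0. On a feasible design e^T M^- e is the value of
    the form of M at w / Delta, namely 1 / Delta. Hence the D_1-criterion is the
    restriction of Delta to the designs where Delta <> 0
    ([D1_feasible_Delta], [D1_value_Delta]), and since Delta >= 0 the two
    maximisation problems have the same solutions, provided that Delta is not
    identically zero.

    That last point is where the assumption that eta is not in the span of f
    enters ([exists_Delta_neq0]). Among all designs take one for which M has
    maximal rank. If Delta were 0 there, then M w = 0; some point x has
    eta x <> theta^T f x, so w leaves the kernel when the mass of x is mixed in,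
    while no new kernel vector can appear. The rank would increase. *)

(** * Quadratic forms *)

Definition qform {R : realType} {k : nat} (M : 'M[R]_k) (u : 'cV[R]_k) : R :=
  (u^T *m M *m u) 0 0.

Lemma qform_line {R : realType} {k : nat} (M : 'M[R]_k) (w d : 'cV[R]_k) (t : R) :
  M^T = M ->
  qform M (w + t *: d) =
    qform M w + (2 * t * (d^T *m (M *m w)) 0 0 + t ^+ 2 * qform M d).
Proof.
move=> Msym; have Mwd : (w^T *m M *m d) 0 0 = (d^T *m (M *m w)) 0 0.
  have <- : (w^T *m M *m d)^T 0 0 = (w^T *m M *m d) 0 0 by rewrite mxE.
  by rewrite !trmx_mul trmxK Msym.
rewrite /qform; have -> : (w + t *: d)^T = w^T + t *: d^T by rewrite linearD linearZ.
rewrite !mulmxDl !mulmxDr -!scalemxAl -!scalemxAr -(mulmxA d^T M w).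
move: (w^T *m M *m w) (d^T *m M *m d) (w^T *m M *m d) (d^T *m (M *m w)) Mwd.
by move=> a b c e ce; rewrite !mxE ce; ring.
Qed.

(** Along the line through [w] with direction [d], the form is a quadratic
    polynomial in [t] with linear coefficient twice the left-hand side below; it
    must vanish if [t = 0] is a minimum. *)
Lemma qform_stationary {R : realType} {k : nat} (M : 'M[R]_k) (w d : 'cV[R]_k) :
  M^T = M -> (forall t, qform M w <= qform M (w + t *: d)) ->
  (d^T *m (M *m w)) 0 0 = 0.
Proof.
move=> Msym wmin; set b := LHS; set a := qform M d.
have ab t : 0 <= 2 * t * b + t ^+ 2 * a.
  by have := wmin t; rewrite qform_line// lerDl.
have c_gt0 : 0 < `|a| + 1 by rewrite ltr_wpDl.
(* This step is short enough for the linear term to dominate, whatever the size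
   of the curvature [a]. *)
have := ab (- b / (`|a| + 1)).
have -> : 2 * (- b / (`|a| + 1)) * b + (- b / (`|a| + 1)) ^+ 2 * a =
    - (b ^+ 2 * ((2 * (`|a| + 1) - a) / (`|a| + 1) ^+ 2)).
  by field; rewrite gt_eqF.
have pos : 0 < (2 * (`|a| + 1) - a) / (`|a| + 1) ^+ 2.
  by rewrite divr_gt0 ?exprn_gt0//; have := ler_norm a; lra.
rewrite oppr_ge0 pmulr_lle0// => b2.
by apply/eqP; rewrite -sqrf_eq0 eq_le b2 sqr_ge0.
Qed.

(** A zero of a nonnegative form is a global minimum, hence stationary in every
    direction. *)
Lemma qform_eq0 {R : realType} {k : nat} (M : 'M[R]_k) (w : 'cV[R]_k) :
  M^T = M -> (forall u, 0 <= qform M u) -> qform M w = 0 -> M *m w = 0.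
Proof.
move=> Msym Mpos Mw0; apply/matrixP => i j; rewrite (ord1 j) [RHS]mxE.
rewrite -(@qform_stationary R k M w (delta_mx i 0))//; last first.
  by move=> t; rewrite Mw0.
by rewrite trmx_delta -rowE [RHS]mxE.
Qed.

(** [w] witnesses that the inclusion of kernels is strict. Symmetry is used to
    pass from column kernels to the row kernels computed by [kermx]. *)
Lemma rank_lt_of_ker {R : realType} {k : nat} (M N : 'M[R]_k) (w : 'cV[R]_k) :
  M^T = M -> N^T = N -> (forall v : 'cV[R]_k, N *m v = 0 -> M *m v = 0) ->
  M *m w = 0 -> N *m w <> 0 -> (\rank M < \rank N)%N.
Proof.
move=> Msym Nsym NM Mw Nw.
have : (kermx N < kermx M)%MS.
  rewrite ltmxE; apply/andP; split.
    apply/row_subP => i; apply/sub_kermxP/trmx_inj.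
    rewrite trmx_mul trmx0 Msym; apply: NM.
    by apply: trmx_inj; rewrite trmx_mul trmxK Nsym trmx0 -row_mul mulmx_ker row0.
  apply/negP => MN; apply: Nw; apply: trmx_inj.
  rewrite trmx_mul Nsym trmx0; apply/sub_kermxP.
  apply: submx_trans MN; apply/sub_kermxP; apply: trmx_inj.
  by rewrite trmx_mul Msym trmxK Mw trmx0.
move=> /rank_ltmx; rewrite !mxrank_ker.
by apply: contraTT; rewrite -!leqNgt; exact: leq_sub2l.
Qed.

(** * Integration against a design *)

Lemma borel_continuous_measurable {R : realType} {X : ptopologicalType}
  (h : X -> R) : continuous h -> measurable_fun [set: borel X] (h : borel X -> R).
Proof.
move=> /continuousP ch; apply: (measurability _ (RGenOpens.measurableE R)).
move=> _ [_ [a [b ->] <-]]; rewrite setTI; apply: sub_sigma_algebra.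
exact/ch/interval_open.
Qed.

(** The values of [h] on the finite support are bounded by some [c]; the set
    where [|h| <= c] is closed and contains the support. It is measurable even
    when the support is not, so it has mass 1, and [h] is bounded on it. *)
Lemma design_integrable {R : realType} {X : ptopologicalType}
  (xi : probability (borel X) R) (h : X -> R) :
  is_design xi -> continuous h -> xi.-integrable setT (EFin \o h).
Proof.
move=> [S /finite_seqP [s ->]] xi1 ch.
have mh := @borel_continuous_measurable R X h ch.
pose c := \sum_(x <- s) `|h x|.
pose A : set (borel X) := h @^-1` `[- c, c]%classic.
have mA : measurable A by rewrite /A -[X in measurable X]setTI; apply: mh.
have xiA : xi A = 1%E.
  apply: xi1 => // x /= xs; rewrite /A /= in_itv /= -ler_norml /c.
  by rewrite (big_rem x)//= lerDl sumr_ge0.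
have xiCA : xi (~` A) = 0%E.
  by rewrite (@probability_setC _ _ _ xi A mA) xiA subee.
apply/(@negligible_integrable _ _ _ xi setT (~` A)) => //.
- exact: measurableC.
- exact/measurable_EFinP.
rewrite setTD setCK; apply: measurable_bounded_integrable => //.
- exact: le_lt_trans (@probability_le1 _ _ _ xi A mA) (ltry 1).
- exact: measurable_funS mh.
exists c; split; first exact: num_real.
by move=> e ce x; rewrite /A /= in_itv /= -ler_norml => /le_trans; apply; apply: ltW.
Qed.

Lemma Rintegral_sum {d} {T : measurableType d} {R : realType}
  (mu : {measure set T -> \bar R}) (I : Type) (s : seq I) (h : I -> T -> R) :
  (forall i, mu.-integrable setT (EFin \o h i)) ->
  \int[mu]_x (\sum_(i <- s) h i x) = \sum_(i <- s) \int[mu]_x h i x.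
Proof.
move=> ih; rewrite /Rintegral; under eq_integral do rewrite -sumEFin.
rewrite integral_sum// sum_fine// => i _.
by apply: integrable_fin_num => //; exact: ih.
Qed.

Lemma qform_info_mx {R : realType} {X : ptopologicalType} {k : nat}
  (xi : probability (borel X) R) (g : X -> 'cV[R]_k) (u : 'cV[R]_k) :
  is_design xi -> (forall i, continuous (fun x => g x i 0)) ->
  qform (info_mx g xi) u = \int[xi]_x ((u^T *m g x) 0 0) ^+ 2.
Proof.
move=> dxi cg.
pose h (p : 'I_k * 'I_k) (x : X) : R := u p.1 0 * u p.2 0 * (g x p.1 0 * g x p.2 0).
have ig (p : 'I_k * 'I_k) :
    xi.-integrable setT (EFin \o (fun x => g x p.1 0 * g x p.2 0)).
  by apply: design_integrable => // x; apply: continuousM; apply: cg.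
transitivity (\int[xi]_x \sum_p h p x).
  rewrite Rintegral_sum; last first.
    by move=> p; exact: (integrableZl measurableT (u p.1 0 * u p.2 0) (ig p)).
  under eq_bigr => p _ do rewrite RintegralZl//.
  rewrite /qform !mxE.
  under [LHS]eq_bigr => j _ do rewrite !mxE big_distrl /=.
  rewrite exchange_big /= pair_big /=; apply: eq_bigr => p _.
  rewrite !mxE.
  under eq_Rintegral => x _ do rewrite !mxE big_ord1 !mxE.
  ring.
apply: eq_Rintegral => x _.
rewrite mxE expr2 big_distrlr /= pair_big /=; apply: eq_bigr => p _.
by rewrite /h !mxE; ring.
Qed.

Lemma qform_info_mx_ge0 {R : realType} {X : ptopologicalType} {k : nat}
  (xi : probability (borel X) R) (g : X -> 'cV[R]_k) (u : 'cV[R]_k) :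
  is_design xi -> (forall i, continuous (fun x => g x i 0)) ->
  0 <= qform (info_mx g xi) u.
Proof.
by move=> dxi cg; rewrite qform_info_mx// Rintegral_ge0// => x _; exact: sqr_ge0.
Qed.

(** * Mixing a design with a one-point design *)

Section AddPoint.
Context {R : realType} {X : ptopologicalType}.
Variables (xi : probability (borel X) R) (x : borel X).

Let half : {nonneg R} := (2^-1)%:nng.

Definition add_point : set (borel X) -> \bar R :=
  measure_add (mscale half xi) (mscale half (\d_x)).

HB.instance Definition _ := Measure.on add_point.

Lemma add_pointE A : add_point A = (2^-1%:E * xi A + 2^-1%:E * \d_x A)%E.
Proof. exact: measure_addE. Qed.

Let add_point_setT : add_point setT = 1%E.
Proof.
by rewrite add_pointE probability_setT diracT !mule1 -EFinD; congr EFin; lra.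
Qed.

HB.instance Definition _ := Measure_isProbability.Build _ _ _ add_point add_point_setT.

Lemma add_point_design : is_design xi -> is_design add_point.
Proof.
move=> [S finS xi1]; exists (S `|` [set x]).
  by rewrite finite_setU; split => //; apply: finite_set1.
move=> A mA SA; transitivity (add_point A) => //; rewrite add_pointE xi1//; last by move=> y Sy; apply: SA; left.
rewrite diracE mem_set; last by apply: SA; right.
by rewrite !mule1 -EFinD; congr EFin; lra.
Qed.

(** Nonnegativity allows the integral against a sum of measures to be split; the
    squares of residuals are the intended application. *)
Lemma Rintegral_add_point (h : X -> R) :
  is_design xi -> continuous h -> (forall y, 0 <= h y) ->
  \int[add_point]_y h y = 2^-1 * \int[xi]_y h y + 2^-1 * h x.
Proof.
move=> dxi ch h0.
have mh : measurable_fun [set: borel X] (EFin \o h).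
  by apply/measurable_EFinP; exact: borel_continuous_measurable.
have fin_xi := integrable_fin_num measurableT (design_integrable xi h dxi ch).
rewrite /Rintegral ge0_integral_measure_add//; last by move=> y _; rewrite lee_fin.
rewrite !ge0_integral_mscale//; do ?by move=> y _; rewrite lee_fin.
rewrite integral_dirac// diracT mul1e -(fineK fin_xi) /=.
by [].
Qed.

End AddPoint.

(** The quadratic form under the mixture is the average of the form under [xi]
    and the square of [u^T g x]. Both terms are nonnegative, so they vanish
    together. *)
Lemma ker_info_mx_add_point {R : realType} {X : ptopologicalType} {k : nat}
  (xi : probability (borel X) R) (x : borel X) (g : X -> 'cV[R]_k)
  (u : 'cV[R]_k) :
  is_design xi -> (forall i, continuous (fun y => g y i 0)) ->
  info_mx g (add_point xi x) *m u = 0 ->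
  info_mx g xi *m u = 0 /\ (u^T *m g x) 0 0 = 0.
Proof.
move=> dxi cg Nu.
pose r (y : X) : R := (u^T *m g y) 0 0.
have r_cont : continuous (fun y => r y ^+ 2).
  have cr : continuous r.
    have -> : r = (fun y => \sum_i u^T 0 i * g y i 0).
      by apply/funext => y; rewrite /r mxE.
    apply: continuous_big; first exact: add_continuous.
    move=> i _ y; apply: continuousM; last exact: cg.
    exact: cst_continuous.
  by move=> y; apply: continuousM; exact: cr.
have : qform (info_mx g (add_point xi x)) u = 0.
  by rewrite /qform -mulmxA Nu mulmx0 mxE.
rewrite (qform_info_mx _ _ _ (add_point_design xi x dxi) cg).
rewrite (Rintegral_add_point xi x (fun y => r y ^+ 2) dxi r_cont); last first.
  by move=> y; exact: sqr_ge0.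
rewrite -qform_info_mx// => /eqP.
have h0 : 0 <= 2^-1 :> R by rewrite invr_ge0.
rewrite paddr_eq0; [|by rewrite mulr_ge0 ?qform_info_mx_ge0|
                     by rewrite mulr_ge0 ?sqr_ge0].
rewrite !mulf_eq0 invr_eq0 pnatr_eq0 /= => /andP[/eqP q0 r0].
split; last by apply/eqP; move: r0; rewrite orbb.
apply: qform_eq0 => // [|v]; [exact: info_mx_sym|exact: qform_info_mx_ge0].
Qed.

(** * The two criteria on a single design *)

Section Criteria.
Context {R : realType} {X : ptopologicalType} {m : nat}.
Variables (eta : X -> R) (f : X -> 'cV[R]_m).
Hypothesis eta_cont : continuous eta.
Hypothesis f_cont : forall i : 'I_m, continuous (fun x : X => f x i 0).
Hypothesis inf_attained : forall xi : probability (borel X) R, is_design xi ->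
  exists theta : 'cV[R]_m, sq_dist eta f xi theta = Delta eta f xi.

Let M xi := info_mx (ext_reg f eta) xi.
Let residual_vec (theta : 'cV[R]_m) : 'cV[R]_(m + 1) := col_mx (- theta) 1%:M.

Let ext_reg_cont (i : 'I_(m + 1)) : continuous (fun x => ext_reg f eta x i 0).
Proof.
have -> : (fun x => ext_reg f eta x i 0) =
    (match fintype.split i with inl j => fun x => f x j 0 | inr _ => eta end).
  apply/funext => x; rewrite mxE; case: fintype.split => // j.
  by rewrite (ord1 j) mxE eqxx mulr1n.
by case: fintype.split.
Qed.

Let residual_vecE theta x :
  ((residual_vec theta)^T *m ext_reg f eta x) 0 0 =
  eta x - (theta^T *m f x) 0 0.
Proof.
rewrite /residual_vec /ext_reg tr_col_mx mul_row_col trmx1 mul1mx.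
by rewrite linearN /= mulNmx !mxE eqxx mulr1n addrC.
Qed.

Let qformM xi u : is_design xi ->
  qform (M xi) u = \int[xi]_x ((u^T *m ext_reg f eta x) 0 0) ^+ 2.
Proof. by move=> dxi; exact: qform_info_mx. Qed.

Let qformM_ge0 xi u : is_design xi -> 0 <= qform (M xi) u.
Proof. by move=> dxi; exact: qform_info_mx_ge0. Qed.

Lemma sq_dist_qform xi theta : is_design xi ->
  sq_dist eta f xi theta = qform (M xi) (residual_vec theta).
Proof.
move=> dxi; rewrite qformM//; apply: eq_Rintegral => x _.
by rewrite residual_vecE.
Qed.

Lemma Delta_ge0 xi : is_design xi -> 0 <= Delta eta f xi.
Proof.
by move=> dxi; have [t <-] := inf_attained xi dxi; rewrite sq_dist_qform// qformM_ge0.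
Qed.

Lemma Delta_le xi theta : is_design xi -> Delta eta f xi <= sq_dist eta f xi theta.
Proof.
move=> dxi; apply: ge_inf; last by exists theta.
by exists 0 => _ [t _ <-]; rewrite sq_dist_qform// qformM_ge0.
Qed.

(** Perturbing [theta] moves [(-theta, 1)] along the directions with last
    coordinate 0, and the minimum is stationary along them: this kills the upper
    block of the product. The lower block is then the value of the form. *)
Lemma normal_equations xi : is_design xi ->
  exists theta, M xi *m residual_vec theta = Delta eta f xi *: e_last.
Proof.
move=> dxi; have [theta thetaE] := inf_attained xi dxi; exists theta.
have Msym : (M xi)^T = M xi := info_mx_sym _ _.
have wE := sq_dist_qform xi theta dxi.
have upE : usubmx (M xi *m residual_vec theta) = 0.
  apply/matrixP => i j; rewrite (ord1 j) [RHS]mxE.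
  have <- : ((col_mx (delta_mx i 0) 0 : 'cV_(m + 1))^T *m
      (M xi *m residual_vec theta)) 0 0 =
      usubmx (M xi *m residual_vec theta) i 0.
    rewrite -[X in _ *m X]vsubmxK tr_col_mx mul_row_col trmx0 mul0mx addr0.
    by rewrite trmx_delta -rowE mxE.
  apply: qform_stationary => // t.
  have -> : residual_vec theta + t *: col_mx (delta_mx i 0) 0 =
      residual_vec (theta - t *: delta_mx i 0).
    by rewrite scale_col_mx add_col_mx scaler0 addr0 /residual_vec opprB addrC.
  by rewrite -!sq_dist_qform// thetaE Delta_le.
have : qform (M xi) (residual_vec theta) = Delta eta f xi by rewrite -wE.
rewrite /qform -mulmxA -[X in _ *m X]vsubmxK upE tr_col_mx mul_row_col mulmx0 add0r.
rewrite trmx1 mul1mx => <-.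
rewrite -[LHS]vsubmxK upE /e_last scale_col_mx scaler0; congr col_mx.
by rewrite [LHS]mx11_scalar -scalemx1.
Qed.

Let e_last_residual theta : e_last^T *m residual_vec theta = 1%:M.
Proof. by rewrite tr_col_mx mul_row_col trmx0 mul0mx add0r trmx1 mul1mx. Qed.

(** A solution of the normal equations with [Delta = 0] is a kernel vector not
    orthogonal to [e_last], which obstructs [e_last] from being in the range of
    a symmetric matrix; with [Delta <> 0] it rescales to a preimage. *)
Lemma D1_feasible_Delta xi : is_design xi ->
  D1_feasible f eta xi <-> Delta eta f xi <> 0.
Proof.
move=> dxi; have [theta Mw] := normal_equations xi dxi; split.
  move=> [v Mv] D0; move: Mw; rewrite D0 scale0r => Mw.
  have : e_last^T *m residual_vec theta = 0.
    by rewrite -Mv trmx_mul info_mx_sym -mulmxA Mw mulmx0.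
  rewrite e_last_residual => /matrixP/(_ 0 0); rewrite !mxE eqxx => /eqP.
  by rewrite oner_eq0.
move=> /eqP D0; exists ((Delta eta f xi)^-1 *: residual_vec theta).
by rewrite -scalemxAr Mw scalerA mulVf// scale1r.
Qed.

(** Any preimage [v] of [e_last] makes the entry of the generalized inverse equal
    to [v^T M v = e_last^T v]; the rescaled solution of the normal equations is
    the preimage for which this number is visible. *)
Lemma D1_value_Delta xi : is_design xi -> D1_feasible f eta xi ->
  D1_value f eta xi = Delta eta f xi.
Proof.
move=> dxi fxi; have [theta Mw] := normal_equations xi dxi.
have /eqP D0 := (D1_feasible_Delta xi dxi).1 fxi.
pose v := (Delta eta f xi)^-1 *: residual_vec theta.
have Mv : M xi *m v = e_last by rewrite -scalemxAr Mw scalerA mulVf// scale1r.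
have Mv' : v^T *m M xi = e_last^T by rewrite -Mv trmx_mul info_mx_sym.
rewrite /D1_value -/(M xi) -[X in _ *m X]Mv -Mv'.
have := pinvmx_ginv (M xi); move: (pinvmx (M xi)) => G MGM.
rewrite !mulmxA -(mulmxA v^T) -(mulmxA v^T) MGM Mv'.
by rewrite -scalemxAr e_last_residual scalemx1 mxE eqxx mulr1n invrK.
Qed.

(** * A design that separates the two models *)

Hypothesis eta_notin_span :
  ~ exists theta : 'cV[R]_m, forall x : X, eta x = (theta^T *m f x) 0 0.

(** Maximality of the rank replaces the search for finitely many points
    that separate [eta] from the span of [f]: a design with [Delta = 0] always
    has a point whose addition increases the rank. *)
Lemma exists_Delta_neq0 :
  exists2 xi : probability (borel X) R, is_design xi & Delta eta f xi <> 0.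
Proof.
pose P n := `[< exists2 xi : probability (borel X) R, is_design xi & \rank (M xi) = n >].
have exP : exists n, P n.
  pose x0 : borel X := point.
  exists (\rank (M (\d_x0))); apply/asboolP; exists \d_x0 => //.
  exists [set x0]; first exact: finite_set1.
  move=> A _ xA; transitivity (\d_x0 A : \bar R)=> //.
  by rewrite diracE mem_set//; exact: xA.
have ubP n : P n -> (n <= m + 1)%N.
  by move=> /asboolP[xi _ <-]; exact: rank_leq_row.
case: (ex_maxnP exP ubP) => n /asboolP[xi dxi rkE] nmax.
exists xi => // D0; have [theta] := normal_equations xi dxi.
rewrite D0 scale0r => Mw.
apply: eta_notin_span; exists theta => x; apply/eqP; rewrite -subr_eq0.
rewrite -residual_vecE; apply/negPn/negP => rx.
pose xi' : probability (borel X) R := add_point xi x.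
have dxi' : is_design xi' := add_point_design xi x dxi.
have /nmax : P (\rank (M xi')) by apply/asboolP; exists xi'.
rewrite leqNgt -rkE => /negP; apply.
apply: (rank_lt_of_ker _ _ (residual_vec theta)) => //; do ?exact: info_mx_sym.
  by move=> v /(ker_info_mx_add_point xi x _ _ dxi ext_reg_cont)[].
by move=> /(ker_info_mx_add_point xi x _ _ dxi ext_reg_cont)[_ /eqP]; apply/negP.
Qed.

End Criteria.

(** * Equivalence of the two criteria *)

Theorem theorem3p1 (R : realType) (X : ptopologicalType) (m2 : nat)
  (eta : X -> R) (f : X -> 'cV[R]_m2)
  (eta_cont : continuous eta)
  (f_cont : forall i : 'I_m2, continuous (fun x : X => f x i 0))
  (eta_notin_span :
    ~ exists theta : 'cV[R]_m2, forall x : X, eta x = (theta^T *m f x) 0 0)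
  (inf_attained : forall xi : probability (borel X) R, is_design xi ->
    exists theta : 'cV[R]_m2, sq_dist eta f xi theta = Delta eta f xi)
  (T_optimal_exists :
    exists xi : probability (borel X) R, T_optimal eta f xi)
  (xi_star : probability (borel X) R) :
  T_optimal eta f xi_star <-> D1_optimal f eta xi_star.
Proof.
have feasE xi := D1_feasible_Delta eta f eta_cont f_cont inf_attained xi.
have valE xi := D1_value_Delta eta f eta_cont f_cont inf_attained xi.
have ge0 xi := Delta_ge0 eta f eta_cont f_cont inf_attained xi.
split=> [[dxi xi_max]|[dxi feas_xi xi_max]].
  have feas_xi : D1_feasible f eta xi_star.
    apply/feasE => // D0.
    have [xi0 dxi0 /eqP] :=
      exists_Delta_neq0 eta f eta_cont f_cont inf_attained eta_notin_span.
    by apply/negP/negPn; rewrite eq_le ge0// -D0 xi_max.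
  split=> // xi dxi' feas_xi'.
  by rewrite !valE//; exact: xi_max.
split=> // xi dxi'.
have [->|/eqP D0] := eqVneq (Delta eta f xi) 0; first exact: ge0.
have feas_xi' : D1_feasible f eta xi by apply/feasE.
by rewrite -(valE xi)// -(valE xi_star)//; exact: xi_max.
Qed.
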